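(* Suppose that the posterior distribution $\tilde\Pi_n(v\in\cdot\mid\tilde Y_n)$ of $v$ in model (L) contracts under $v_0$ to $v_0=\mathcal L u_{f_0}$ at rate $\epsilon_n$ in the normed space $(V,\|\cdot\|)$, and satisfies $\tilde\Pi_n(v\in V_n\mid\tilde Y_n)\to1$ in probability (under $v_0$) for given sets $V_n\subset V$. If the identity $f=e(\mathcal L u_f)$ holds for a map $e$ such that $e:V_n\to L_2(\mathcal O)$ is Lipschitz at $v_0$, i.e. there is a constant $C$ (not depending on $n$) with $\|e(v)-e(v_0)\|_{L_2}\le C\|v-v_0\|$ for all $v\in V_n$, then the posterior distribution of $f$ in model (N) attains the rate of contraction $\epsilon_n$ under $f_0$ relative to the $L_2$-norm.
   Context: Setting. $\mathcal O\subset\mathbb R^d$ is a bounded connected open set with Lipschitz boundary, $\Gamma\subseteq\partial\mathcal O$, $g:\Gamma\to\mathbb R$ is known, $\mathcal L$ is a linear differential operator and $c$ maps pairs of functions to functions on $\mathcal O$. For an unknown function $f$ on $\mathcal O$, $u_f$ denotes the solution of $\mathcal L u_f=c(f,u_f)$ on $\mathcal O$, $u_f=g$ on $\Gamma$. The linear operator $K$ is the inverse of $\mathcal L$ under zero boundary condition: $\mathcal L Ku=u$ on $\mathcal O$, $Ku=0$ on $\Gamma$. The function $\tilde g$ satisfies $\mathcal L\tilde g=0$ on $\mathcal O$, $\tilde g=g$ on $\Gamma$. It is assumed that $v=0$ is the only solution of $\mathcal Lv=0$ on $\mathcal O$, $v=0$ on $\Gamma$; hence $u_f=K\mathcal L u_f+\tilde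 g$. The map $e$ is a solution map, i.e. $f=e(\mathcal L u_f)$. Observations. $Y_n=u_f+n^{-1/2}\dot{\mathbb W}$ means either (white noise) the Gaussian process $Y_n(h)=\langle h,u_f\rangle_{L_2}+n^{-1/2}\dot{\mathbb W}(h)$, $h\in L_2(\mathcal O)$, with $\dot{\mathbb W}$ mean-zero Gaussian with covariance $\mathrm{cov}(\dot{\mathbb W}(h_1),\dot{\mathbb W}(h_2))=\langle h_1,h_2\rangle_{L_2}$, or (discrete) the vector in $\mathbb R^n$ with coordinates $u_f(x_{n,i})+W_i$, for given design points $x_{n,1},\dots,x_{n,n}\in\mathcal O$ and i.i.d. standard normal $W_i$. Set $\tilde Y_n=Y_n-\tilde g$. Posteriors. A prior (a Borel law on a normed space $(V,\|\cdot\|)$) is put on $v=\mathcal L u_f$. Model (L): $\tilde\Pi_n(v\in\cdot\mid\tilde Y_n)$ is the posterior of $v$ in the model $\tilde Y_n=Kv+n^{-1/2}\dot{\mathbb W}$. Model (N): $\Pi_n(f\in\cdot\mid Y_n)$ is the posterior of $f$ in the model $Y_n=u_f+n^{-1/2}\dot{\mathbb W}$ under the prior on $f=e(v)$ induced by the prior on $v$; it equals $\tilde\Pi_n(e(v)\in\cdot\mid\tilde Y_n)$ with $\tilde Y_n=Y_n-\tilde g$. The map $e$ is assumed defined on a set of full prior probability; if $v$ is not of the form $\mathcal L u_f$ for a solution $u_f$ of the PDE, one defines $f=e(v)$ and $u_f=Kv+\tilde g$, so that $v=\mathcal L u_f$, $f=e(\mathcal L u_f)$ and $u_f=K\mathcal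 L u_f+\tilde g$ always hold. A posterior contracts to a point $\theta_0$ at rate $\epsilon_n\to0$ relative to a norm if, for every $M_n\to\infty$, the posterior probability of $\{\theta:\|\theta-\theta_0\|\ge M_n\epsilon_n\}$ tends to $0$ in probability when the data are generated under the true parameter $\theta_0$. *)

(* Defs.v *)
From HB Require Import structures.
From mathcomp Require Import all_boot all_order all_algebra.
From mathcomp Require Import all_classical all_reals all_analysis.

Set Implicit Arguments.
Unset Strict Implicit.
Unset Printing Implicit Defensive.
Import Order.TTheory GRing.Theory Num.Theory.
Import numFieldNormedType.Exports.

Local Open Scope classical_set_scope.
Local Open Scope ring_scope.

Lemma sigma_finite_product d1 d2 (T1 : measurableType d1)
    (T2 : measurableType d2) (R : realType)
    (m1 : {sigma_finite_measure set T1 -> \bar R})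
    (m2 : {sigma_finite_measure set T2 -> \bar R}) :
  sigma_finite setT (m1 \x m2)%E.
Proof.
have /sigma_finiteP[F [TF ndF Foo]] := sigma_finiteT m1.
have /sigma_finiteP[G [TG ndG Goo]] := sigma_finiteT m2.
exists (fun n => F n `*` G n).
  rewrite -setXTT TF TG predeqE => -[x y]; split.
    move=> [/= [n _ Fnx] [k _ Gky]]; exists (maxn n k) => //; split.
    - by move: x Fnx; exact/subsetPset/ndF/leq_maxl.
    - by move: y Gky; exact/subsetPset/ndG/leq_maxr.
  by move=> [n _ []/= ? ?]; split; exists n.
move=> k; have [? ?] := Foo k; have [? ?] := Goo k.
split; first exact: measurableX.
by rewrite product_measure1E// lte_mul_pinfty// ge0_fin_numE.
Qed.

Section lebesgue_cons.
Context (R : realType) (n : nat).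
Variable mu : {sigma_finite_measure set (n.-tuple R) -> \bar R}.

Let f (p : R * n.-tuple R) : n.+1.-tuple R := [tuple of p.1 :: p.2].

Let mf : measurable_fun [set: R * n.-tuple R] f.
Proof. exact: measurable_cons. Qed.

(* The product of the one-dimensional Lebesgue measure and mu, transported to
   n.+1.-tuple R. *)
Definition lebesgue_cons : set (n.+1.-tuple R) -> \bar R :=
  pushforward (@lebesgue_measure R \x mu)%E f.

Let lc0 : lebesgue_cons set0 = 0%E.
Proof. by rewrite /lebesgue_cons /pushforward preimage_set0 measure0. Qed.

Let lc_ge0 A : (0 <= lebesgue_cons A)%E.
Proof. exact: measure_ge0. Qed.

Let lc_sigma : semi_sigma_additive lebesgue_cons.
Proof.
move=> F mF tF mUF; rewrite /lebesgue_cons /pushforward preimage_bigcup.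
apply: measure_semi_sigma_additive.
- by move=> k; rewrite -[X in measurable X]setTI; exact: mf.
- apply/trivIsetP => /= i j _ _ ij; rewrite -preimage_setI.
  by move/trivIsetP : tF => /(_ _ _ _ _ ij) ->//; rewrite preimage_set0.
- by rewrite -preimage_bigcup -[X in measurable X]setTI; exact: mf.
Qed.

HB.instance Definition _ := isMeasure.Build _ _ _ lebesgue_cons
  lc0 lc_ge0 lc_sigma.

Let lc_sigma_finite : sigma_finite setT lebesgue_cons.
Proof.
have [F FT Foo] := sigma_finite_product (@lebesgue_measure R) mu.
pose g (t : n.+1.-tuple R) := (thead t, [tuple of behead t]) : R * n.-tuple R.
have mg : measurable_fun setT g.
  apply/measurable_fun_pairP; split; first exact: measurable_tnth.
  exact: measurable_behead.
have gf p : g (f p) = p.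
  case: p => x t; rewrite /g /f /=; congr pair; exact/val_inj.
exists (fun i => g @^-1` F i); first by rewrite -preimage_bigcup -FT.
move=> i; have [mFi Fioo] := Foo i; split.
  by rewrite -[X in measurable X]setTI; exact: mg.
rewrite /lebesgue_cons /pushforward -comp_preimage.
by rewrite (_ : g \o f = id)//; apply/funext => p /=; exact: gf.
Qed.

HB.instance Definition _ := Measure_isSigmaFinite.Build _ _ _ lebesgue_cons
  lc_sigma_finite.

End lebesgue_cons.

Fixpoint lebesgue_tuple (R : realType) (n : nat) :
    {sigma_finite_measure set (n.-tuple R) -> \bar R} :=
  match n with
  | 0 => \d_([tuple] : 0.-tuple R)
  | m.+1 => lebesgue_cons (lebesgue_tuple R m)
  end.

Definition tuple_of_rV (R : realType) (d : nat) (v : 'rV[R]_d) : d.-tuple R :=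
  [tuple v ord0 i | i < d].

Definition rV_of_tuple (R : realType) (d : nat) (t : d.-tuple R) : 'rV[R]_d :=
  \row_i tnth t i.

(* 'rV[R]_d with the product sigma-algebra of its coordinates, which is the
   Borel sigma-algebra; `space R d` is convertible to 'rV[R]_d. *)
Definition space (R : realType) (d : nat) :=
  g_sigma_algebra_preimageType (@tuple_of_rV R d).

Section lebesgue_rV.
Context (R : realType) (d : nat).

Definition lebesgue_rV : set (space R d) -> \bar R :=
  fun A => lebesgue_tuple R d (@rV_of_tuple R d @^-1` A).

Let mphi : measurable_fun setT (@rV_of_tuple R d : d.-tuple R -> space R d).
Proof.
move=> _ _ [B mB <-]; rewrite !setTI.
rewrite (_ : _ @^-1` _ = B)//; apply/seteqP; split => t /=;
  rewrite (_ : tuple_of_rV _ = t)//;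
  by apply: eq_from_tnth => i; rewrite tnth_mktuple mxE.
Qed.

Let leb0 : lebesgue_rV set0 = 0%E.
Proof. by rewrite /lebesgue_rV preimage_set0 measure0. Qed.

Let leb_ge0 A : (0 <= lebesgue_rV A)%E.
Proof. exact: measure_ge0. Qed.

Let leb_sigma : semi_sigma_additive lebesgue_rV.
Proof.
move=> F mF tF mUF; rewrite /lebesgue_rV preimage_bigcup.
apply: measure_semi_sigma_additive.
- by move=> k; rewrite -[X in measurable X]setTI; exact: mphi.
- apply/trivIsetP => /= i j _ _ ij; rewrite -preimage_setI.
  by move/trivIsetP : tF => /(_ _ _ _ _ ij) ->//; rewrite preimage_set0.
- by rewrite -preimage_bigcup -[X in measurable X]setTI; exact: mphi.
Qed.

HB.instance Definition _ := isMeasure.Build _ _ _ lebesgue_rV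
  leb0 leb_ge0 leb_sigma.

End lebesgue_rV.

Section domain.
Context (R : realType) (d : nat).
Implicit Types (O : set 'rV[R]_d) (x y nu : 'rV[R]_d) (u h : 'rV[R]_d -> R).

Definition dot x y : R := \sum_i x ord0 i * y ord0 i.

Definition boundary O : set 'rV[R]_d := closure O `\` interior O.

(* Near each boundary point p, O is the part of space above the graph of a
   Lipschitz function phi of the coordinates orthogonal to a unit vector nu:
   phi is defined on the whole space and constant along nu. *)
Definition lipschitz_boundary O : Prop :=
  forall p, boundary O p ->
  exists (nu : 'rV[R]_d) (phi : 'rV[R]_d -> R) (k r : R),
    [/\ 0 < r, dot nu nu = 1,
        forall x y, `|phi x - phi y| <= k * `|x - y|,
        forall x t, phi (x + t *: nu) = phi x &
        forall x, ball p r x -> (O x <-> phi x < dot x nu)].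

(* Functions on O are functions on 'rV[R]_d of which only the values on O
   matter (on O and Gamma for functions with boundary values). *)

Definition L2 O u : Prop := (u \_ O) \in Lfun (@lebesgue_rV R d) 2%:E.

Definition L2norm O u : \bar R :=
  ('N[@lebesgue_rV R d]_2%:E [EFin \o (u \_ O)])%E.

Definition L2inner O u h : R :=
  (\int[@lebesgue_rV R d]_x ((u \_ O) x * (h \_ O) x))%R.

Definition L2fun O := {h : 'rV[R]_d -> R | L2 O h}.

Fixpoint iter_partial (s : seq 'I_d) u : 'rV[R]_d -> R :=
  if s is i :: s' then fun x => 'D_(delta_mx ord0 i) (iter_partial s' u) x
  else u.

Definition smooth O (m : nat) u : Prop :=
  (forall s : seq 'I_d, (size s <= m)%N ->
    forall x, O x -> {for x, continuous (iter_partial s u)}) /\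
  (forall (s : seq 'I_d) (i : 'I_d), (size s < m)%N ->
    forall x, O x -> derivable (iter_partial s u) x (delta_mx ord0 i)).

(* L is a linear operator on a linear space D of functions; on the functions
   of D that are m times continuously differentiable in O it is the expression
   sum_k a_k(x) d^{s_k} u(x), with a finite family of coefficient functions a_k
   and multi-indices s_k of length at most m.  Functions in D of lower
   regularity are allowed, so that L may act on them in a weak sense. *)
Definition linear_differential_operator O (D : set ('rV[R]_d -> R))
    (L : ('rV[R]_d -> R) -> 'rV[R]_d -> R) : Prop :=
  [/\ D (fun=> 0),
      forall (a : R) u h, D u -> D h ->
        D (fun x => a * u x + h x) /\
        (forall x, O x -> L (fun y => a * u y + h y) x = a * L u x + L h x) &
      exists (m : nat) (terms : seq (('rV[R]_d -> R) * seq 'I_d)),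
        all (fun t => (size t.2 <= m)%N) terms /\
        forall u, D u -> smooth O m u -> forall x, O x ->
          L u x = \sum_(t <- terms) t.1 x * iter_partial t.2 u x].

Definition pde_solution O (Gamma : set 'rV[R]_d) (D : set ('rV[R]_d -> R))
    (L : ('rV[R]_d -> R) -> 'rV[R]_d -> R) (rhs g u : 'rV[R]_d -> R) : Prop :=
  [/\ D u, forall x, O x -> L u x = rhs x & forall x, Gamma x -> u x = g x].

End domain.

Section spaces.
Context (R : realType).

Definition borel (V : normedModType R) := g_sigma_algebraType (@open V).

Definition cylinders (I : Type) : set (set (I -> R)) :=
  [set A | exists (i : I) (B : set R),
    measurable B /\ A = (fun y : I -> R => y i) @^-1` B].

Definition data (I : Type) := g_sigma_algebraType (@cylinders I).

(* All functions, with the sigma-algebra generated by the L2(O)-balls centred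
   in L2(O); on L2(O), which is separable, it is the Borel sigma-algebra of the
   L2-norm. *)
Definition L2_balls (d : nat) (O : set 'rV[R]_d) : set (set ('rV[R]_d -> R)) :=
  [set A | exists (h : 'rV[R]_d -> R) (r : R),
    L2 O h /\ A = [set f | (L2norm O (fun x => f x - h x)%R < r%:E)%E]].

Definition fun_space (d : nat) (O : set 'rV[R]_d) :=
  g_sigma_algebraType (L2_balls O).

End spaces.

Section observations.
Context (R : realType) (d : nat).

Inductive scheme := white_noise | discrete of (forall n, 'I_n -> 'rV[R]_d).

Definition design_in (O : set 'rV[R]_d) (s : scheme) : Prop :=
  match s with
  | white_noise => True
  | discrete x => forall n i, O (x n i)
  end.

Context (O : set 'rV[R]_d).

Definition obs_index (s : scheme) (n : nat) : Type :=
  match s with white_noise => L2fun O | discrete _ => 'I_n end.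

Definition obs_mean (s : scheme) (n : nat) (u : 'rV[R]_d -> R) :
    obs_index s n -> R :=
  match s return obs_index s n -> R with
  | white_noise => fun h => L2inner O (sval h) u
  | discrete x => fun i => u (x n i)
  end.

Definition observable (s : scheme) (u : 'rV[R]_d -> R) : Prop :=
  match s with white_noise => L2 O u | discrete _ => True end.

Definition noise_level (s : scheme) (n : nat) : R :=
  match s with white_noise => (Num.sqrt n%:R)^-1 | discrete _ => 1 end.

Context (dW : measure_display) (Omega : measurableType dW)
  (P : probability Omega R).

(* Degenerate laws are Gaussian; normal_prob is not a Dirac mass for s = 0. *)
Definition gaussian (X : Omega -> R) : Prop :=
  exists m s : R, 0 <= s /\
    forall A : set R, measurable A ->
      P (X @^-1` A) = (if s == 0 then \d_m A else normal_prob m s A).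

Definition is_white_noise (W : L2fun O -> {RV P >-> R}) : Prop :=
  [/\ forall (k : nat) (h : 'I_k -> L2fun O) (a : 'I_k -> R),
        gaussian (fun w => \sum_i a i * W (h i) w),
      forall h, ('E_P[W h] = 0)%E &
      forall h1 h2,
        covariance P (W h1) (W h2) = (L2inner O (sval h1) (sval h2))%:E].

Definition iid_std_normal (n : nat) (W : 'I_n -> {RV P >-> R}) : Prop :=
  (forall i (A : set R), measurable A ->
    P (W i @^-1` A) = normal_prob 0 1 A) /\
  (forall (J : {set 'I_n}) (A : 'I_n -> set R), (forall i, measurable (A i)) ->
    P (\bigcap_(i in [set` J]) (W i @^-1` A i)) =
      (\prod_(i in J) P (W i @^-1` A i))%E).

Definition is_noise (s : scheme) (n : nat) :
    (obs_index s n -> {RV P >-> R}) -> Prop :=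
  match s return (obs_index s n -> {RV P >-> R}) -> Prop with
  | white_noise => fun W => is_white_noise W
  | discrete _ => fun W => iid_std_normal W
  end.

Definition observation (s : scheme) (n : nat) (W : obs_index s n -> {RV P >-> R})
    (u : 'rV[R]_d -> R) (w : Omega) : data R (obs_index s n) :=
  fun i => obs_mean u i + noise_level s n * W i w.

Definition recentre (s : scheme) (n : nat) (gt : 'rV[R]_d -> R)
    (y : data R (obs_index s n)) : data R (obs_index s n) :=
  fun i => y i - obs_mean gt i.

End observations.

(* Pi is a version of the conditional law of theta(v) given Y(v, w), when v is
   drawn from the prior and w, independently, from P.  The parameter theta is
   defined on a set E of full prior probability. *)
Definition is_posterior (R : realType) d1 d2 d3 d4 (T : measurableType d1)
    (Omega : measurableType d2) (Th : measurableType d3)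
    (X : measurableType d4) (prior : probability T R) (P : probability Omega R)
    (E : set T) (theta : T -> Th) (Y : T -> Omega -> X)
    (Pi : R.-pker X ~> Th) : Prop :=
  [/\ measurable E /\ prior E = 1%E,
      measurable_fun E theta,
      measurable_fun setT (fun z : T * Omega => Y z.1 z.2) &
      forall (A : set X) (B : set Th), measurable A -> measurable B ->
        (prior \x P)%E
          [set z | [/\ E z.1, B (theta z.1) & A (Y z.1 z.2)]] =
        (\int[(prior \x P)%E]_(z in [set z | A (Y z.1 z.2)])
          Pi (Y z.1 z.2) B)%E].

Definition cvg_in_probability (R : realType) dW (Omega : measurableType dW)
    (P : probability Omega R) (X : nat -> Omega -> \bar R) (l : R) : Prop :=
  forall delta : R, 0 < delta ->
    (fun n => P [set w | (delta%:E <= `|X n w - l%:E|)%E]) @ \oo --> 0%E.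

(* dist is the distance to the true parameter, Y n the data generated under
   the true parameter. *)
Definition contracts (R : realType) dW (Omega : measurableType dW)
    (P : probability Omega R) (X : nat -> Type) (Th : Type)
    (Pi : forall n, X n -> set Th -> \bar R) (Y : forall n, Omega -> X n)
    (dist : Th -> \bar R) (eps : nat -> R) : Prop :=
  eps @ \oo --> (0 : R) /\
  forall M : nat -> R, M @ \oo --> +oo ->
    cvg_in_probability P
      (fun n w => Pi n (Y n w) [set t | ((M n * eps n)%:E <= dist t)%E]) 0.

(* Main.v *)
(* The data of model (N), recentred at gt, are the data of model (L) at v0, since
   u f0 = K v0 + gt on O by uniqueness for L.  On Vn the distance of e v to f0 in
   L2 is at most max(C, 1) * |v - v0|; hence the posterior mass of an L2-ball
   complement around f0 is at most the mass of the complement of a ball around v0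
   with radius smaller by the factor max(C, 1), plus the mass of ~` Vn. *)

Require Import Defs.
From HB Require Import structures.
From mathcomp Require Import all_boot all_order all_algebra.
From mathcomp Require Import all_classical all_reals all_analysis.
From mathcomp Require Import measurable_realfun ring lra.

Set Implicit Arguments.
Unset Strict Implicit.
Unset Printing Implicit Defensive.
Import Order.TTheory GRing.Theory Num.Theory.
Import numFieldNormedType.Exports.

Local Open Scope classical_set_scope.
Local Open Scope ring_scope.

(** If a sum of two terms reaches [e], one of them reaches [e / 2], so a union bound applies. The
    bound is asked only eventually and almost surely because the two posteriors are identified only
    for positive [n] and off a null set. *)
Lemma cvg_in_probability_le_add (R : realType) d (T : measurableType d)
    (P : probability T R) (X Y Z : nat -> T -> \bar R) (l1 l2 l3 : R) :
  (forall n, measurable_fun setT (X n)) ->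
  (forall n, measurable_fun setT (Y n)) ->
  (forall n, measurable_fun setT (Z n)) ->
  (\forall n \near \oo, {ae P, forall w,
    (`|X n w - l1%:E| <= `|Y n w - l2%:E| + `|Z n w - l3%:E|)%E}) ->
  cvg_in_probability P Y l2 -> cvg_in_probability P Z l3 ->
  cvg_in_probability P X l1.
Proof.
move=> mX mY mZ XYZ cY cZ e e0.
have mge (U : nat -> T -> \bar R) l r n : measurable_fun setT (U n) ->
    measurable [set w | (r%:E <= `|U n w - l%:E|)%E].
  move=> mU; rewrite -[X in measurable X]setTI; apply: emeasurable_fun_c_infty => //.
  by apply: measurableT_comp => //; apply: emeasurable_funB.
have e2 : 0 < e / 2 by rewrite divr_gt0.
have /(_ _) cYZ := cvgeD (isT : ((0 : \bar R) +? 0)%E) (cY _ e2) (cZ _ e2).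
rewrite adde0 in cYZ.
apply: squeeze_cvge (cvg_cst 0%E) cYZ.
near=> n; rewrite measure_ge0 /=.
have [N [mN N0 XN]] : {ae P, forall w,
  (`|X n w - l1%:E| <= `|Y n w - l2%:E| + `|Z n w - l3%:E|)%E} by near: n.
have mYn := mge _ l2 (e / 2) _ (mY n); have mZn := mge _ l3 (e / 2) _ (mZ n).
have mXn := mge _ l1 e _ (mX n).
(* Adjoining the null set [N] makes the inclusion hold pointwise. *)
apply: (@le_trans _ _ (P ([set w | ((e / 2)%:E <= `|Y n w - l2%:E|)%E] `|`
  [set w | ((e / 2)%:E <= `|Z n w - l3%:E|)%E] `|` N))).
  apply: le_measure; rewrite ?inE//; first by do 2 apply: measurableU => //.
  move=> w /= eX; have [Nw|nNw] := pselect (N w); [by right|left].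
  have XYZw : (`|X n w - l1%:E| <= `|Y n w - l2%:E| + `|Z n w - l3%:E|)%E.
    by apply: contrapT => nle; apply/nNw/XN.
  have [|Yw] := leP (e / 2)%:E `|Y n w - l2%:E|%E; first by left.
  have [|Zw] := leP (e / 2)%:E `|Z n w - l3%:E|%E; first by right.
  have := le_lt_trans (le_trans eX XYZw) (lteD Yw Zw).
  by rewrite -EFinD -splitr ltxx.
apply: le_trans (measureU2 _ _ mN) _; first exact: measurableU.
by rewrite [X in (_ + X)%E]N0 adde0; exact: measureU2.
Unshelve. all: by end_near. Qed.

Lemma measurable_observation (R : realType) (d : nat) (O : set 'rV[R]_d)
    (s : scheme R d) dW (Omega : measurableType dW) (P : probability Omega R)
    n (W : obs_index O s n -> {RV P >-> R}) (u : 'rV[R]_d -> R) :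
  measurable_fun setT (observation W u).
Proof.
apply: (@measurability _ _ Omega (data R (obs_index O s n)) setT _
  (@cylinders R (obs_index O s n))) => // _ [_ [i [B [mB ->]]] <-].
suff: measurable_fun setT (fun w => obs_mean u i + noise_level s n * W i w).
  by apply.
by apply: measurable_funD => //; apply: measurable_funM.
Qed.

Lemma L2inner_eqD (R : realType) (d : nat) (O : set 'rV[R]_d)
    (h u v w : 'rV[R]_d -> R) :
  L2 O h -> L2 O v -> L2 O w -> (forall x, O x -> u x = v x + w x) ->
  L2inner O h u = L2inner O h v + L2inner O h w.
Proof.
move=> Lh Lv Lw uvw; rewrite /L2inner -RintegralD//.
- apply: eq_Rintegral => x _; rewrite -mulrDr; congr (_ * _).
  rewrite !patchE; case: ifPn => [|_]; last by rewrite addr0.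
  by rewrite inE => /uvw.
- by apply/Lfun1_integrable; exact: Lfun2_mul_Lfun1.
- by apply/Lfun1_integrable; exact: Lfun2_mul_Lfun1.
Qed.

(** Recentring leaves the noise untouched, so only the means are compared: by additivity of the
    inner product for white noise, by evaluation at design points of [O] otherwise. *)
Lemma recentre_observation (R : realType) (d : nat) (O : set 'rV[R]_d)
    (s : scheme R d) dW (Omega : measurableType dW) (P : probability Omega R)
    n (W : obs_index O s n -> {RV P >-> R}) (u v w : 'rV[R]_d -> R) :
  design_in O s -> observable O s v -> observable O s w ->
  (forall x, O x -> u x = v x + w x) ->
  (fun z => recentre w (observation W u z)) = observation W v.
Proof.
move=> Os Lv Lw uvw; apply/funext => z; apply/funext => i.
rewrite /recentre /observation addrAC; congr (_ + _).
apply/eqP; rewrite subr_eq; apply/eqP.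
case: s n W Os Lv Lw i => [|x] n W /= Os Lv Lw i; last exact: uvw.
by apply: L2inner_eqD => //; exact: (svalP i).
Qed.

Lemma eq_L2norm (R : realType) (d : nat) (O : set 'rV[R]_d)
    (u v : 'rV[R]_d -> R) :
  (forall x, O x -> u x = v x) -> L2norm O u = L2norm O v.
Proof.
move=> uv; apply: eq_Lnorm => x /=; rewrite !patchE.
by case: ifPn => //; rewrite inE => /uv ->.
Qed.

(** The difference [w - k - gt] solves the homogeneous problem, hence vanishes on [O]. *)
Lemma pde_solution_decomposition (R : realType) (d : nat)
    (O Gamma : set 'rV[R]_d) D L (rhs g gt k w : 'rV[R]_d -> R) :
  linear_differential_operator O D L ->
  (forall w, pde_solution O Gamma D L (fun=> 0) (fun=> 0) w ->
    forall x, O x -> w x = 0) ->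
  pde_solution O Gamma D L (fun=> 0) g gt ->
  pde_solution O Gamma D L rhs (fun=> 0) k ->
  pde_solution O Gamma D L rhs g w ->
  forall x, O x -> w x = k x + gt x.
Proof.
move=> [_ linL _] uniq [Dgt Lgt bgt] [Dk Lk bk] [Dw Lw bw] x Ox.
have [Dkw Lkw] := linL (-1) _ _ Dk Dw.
have [Dz Lz] := linL (-1) _ _ Dgt Dkw.
have /uniq/(_ x Ox) : pde_solution O Gamma D L (fun=> 0) (fun=> 0)
    (fun y => -1 * gt y + (-1 * k y + w y)).
  split => // y Hy; first by rewrite Lz// Lgt// Lkw// Lk// Lw//; ring.
  by rewrite bgt// bk// bw//; ring.
lra.
Qed.

Lemma measurable_normB_ge (R : realType) (V : normedModType R) (v0 : V) (r : R) :
  measurable ([set v | r%:E <= `|v - v0|%:E]%E : set (borel V)).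
Proof.
rewrite (_ : [set v | _] = ~` [set v : V | `|v - v0| < r]).
  apply: measurableC; apply: sub_sigma_algebra.
  have cf : continuous (fun v : V => `|v - v0|).
    by move=> v; apply: cvg_norm; apply: cvgB => //; exact: cvg_cst.
  by apply: (@open_comp _ _ (fun v : V => `|v - v0|) [set x | x < r]) => //;
    exact: open_lt.
by apply/seteqP; split=> v /=; rewrite lee_fin leNgt => /negP.
Qed.

Lemma measurable_L2norm_ge (R : realType) (d : nat) (O : set 'rV[R]_d)
    (h : 'rV[R]_d -> R) (r : R) : L2 O h ->
  measurable ([set f | r%:E <= L2norm O (fun x => f x - h x)%R]%E :
    set (fun_space O)).
Proof.
move=> Lh.
rewrite (_ : [set f | _] =
  ~` [set f : 'rV[R]_d -> R | (L2norm O (fun x => f x - h x)%R < r%:E)%E]).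
  by apply: measurableC; apply: sub_sigma_algebra; exists h, r.
by apply/seteqP; split=> v /=; rewrite leNgt => /negP.
Qed.

(** [S] is covered by [B] and the complement of [A], whose mass is the distance of [P A] from 1. *)
Lemma probability_diff_bound (R : realType) d (T : measurableType d)
    (P : {measure set T -> \bar R}) (A B S : set T) : P setT = 1%E ->
  measurable A -> measurable B -> measurable S -> S `&` A `<=` B ->
  (`|P S - 0| <= `|P B - 0| + `|P A - 1|)%E.
Proof.
move=> P1 mA mB mS SAB.
have PA1 : (P A <= 1)%E by rewrite -P1; apply: le_measure; rewrite ?inE.
have PA : P A \is a fin_num by rewrite ge0_fin_numE// (le_lt_trans PA1)// ltry.
have -> : (`|P A - 1| = P (~` A))%E.
  transitivity (P setT - P (setT `&` A))%E.
    by rewrite P1 setTI lee0_abs ?sube_le0// fin_num_oppeB// addeC.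
  by rewrite -setTD -measureD// [ltLHS]P1 ltry.
rewrite !sube0 !gee0_abs//.
apply: le_trans (measureU2 _ mB (measurableC mA)).
apply: le_measure; rewrite ?inE//; first by apply: measurableU => //; exact: measurableC.
by move=> x Sx; have [Ax|] := pselect (A x); [left; exact: SAB|right].
Qed.

Theorem proposition2p1 (R : realType) (d : nat)
  (* domain and PDE *)
  (O Gamma : set 'rV[R]_d)
  (D : set ('rV[R]_d -> R)) (L : ('rV[R]_d -> R) -> 'rV[R]_d -> R)
  (c : ('rV[R]_d -> R) -> ('rV[R]_d -> R) -> 'rV[R]_d -> R)
  (g gt : 'rV[R]_d -> R)
  (F : set ('rV[R]_d -> R)) (u : ('rV[R]_d -> R) -> 'rV[R]_d -> R)
  (* parameter space V of functions on O, inverse operator K, solution map e *)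
  (V : normedModType R) (rep : V -> 'rV[R]_d -> R) (K : V -> 'rV[R]_d -> R)
  (De : set V) (e : V -> 'rV[R]_d -> R)
  (* observations *)
  (s : scheme R d) (dW : measure_display) (Omega : measurableType dW)
  (P : probability Omega R)
  (W : forall n : nat, obs_index O s n -> {RV P >-> R})
  (* prior and posteriors *)
  (prior : probability (borel V) R)
  (PiL : forall n : nat, R.-pker (data R (obs_index O s n)) ~> (borel V))
  (PiN : forall n : nat, R.-pker (data R (obs_index O s n)) ~> (fun_space O))
  (* truth, rate, sieves *)
  (f0 : 'rV[R]_d -> R) (v0 : V) (eps : nat -> R) (Vn : nat -> set V) (C : R) :
  (0 < d)%N ->
  bounded_set O -> connected O -> open O -> lipschitz_boundary O ->
  Gamma `<=` boundary O ->
  linear_differential_operator O D L ->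
  (* u f is the solution of L u = c(f, u) on O, u = g on Gamma *)
  (forall f, F f ->
    pde_solution O Gamma D L (c f (u f)) g (u f) /\
    (forall w, pde_solution O Gamma D L (c f w) g w ->
      forall x, O x -> w x = u f x)) ->
  (* only v = 0 solves L v = 0 on O, v = 0 on Gamma *)
  (forall w, pde_solution O Gamma D L (fun=> 0) (fun=> 0) w ->
    forall x, O x -> w x = 0) ->
  pde_solution O Gamma D L (fun=> 0) g gt ->
  (* rep identifies V with a linear space of functions on O *)
  (forall (a : R) (v w : V) x, O x -> rep (a *: v + w) x = a * rep v x + rep w x) ->
  (forall v : V, (forall x, O x -> rep v x = 0) -> v = 0) ->
  (* K inverts L under zero boundary condition *)
  (forall (a : R) (v w : V) x, O x -> K (a *: v + w) x = a * K v x + K w x) ->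
  (forall v : V, pde_solution O Gamma D L (rep v) (fun=> 0) (K v)) ->
  design_in O s ->
  observable O s gt -> (forall v : V, observable O s (K v)) ->
  (forall n, is_noise (W n)) ->
  (* posterior of v in model (L), posterior of f = e(v) in model (N) *)
  (forall n, (0 < n)%N ->
    is_posterior prior P setT (fun v : borel V => v : borel V)
      (fun v w => observation (W n) (K v) w) (PiL n)) ->
  (forall n, (0 < n)%N ->
    is_posterior prior P De (fun v : borel V => e v : fun_space O)
      (fun v w => observation (W n) (fun x => K v x + gt x) w) (PiN n)) ->
  (* the posterior of f is the law of e(v) under the posterior of v *)
  (forall n, (0 < n)%N -> forall B : set (fun_space O), measurable B ->
    {ae P, forall w,
      PiN n (observation (W n) (u f0) w) B =
      PiL n (recentre gt (observation (W n) (u f0) w))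
        [set v : borel V | De v /\ B (e v)]}) ->
  F f0 -> L2 O f0 -> (forall x, O x -> rep v0 x = L (u f0) x) ->
  contracts P (fun n y (A : set V) => PiL n y A)
    (fun n w => observation (W n) (K v0) w)
    (fun v : V => `|v - v0|%:E) eps ->
  (forall n, measurable (Vn n : set (borel V))) ->
  cvg_in_probability P
    (fun n w => PiL n (observation (W n) (K v0) w) (Vn n)) 1 ->
  (* the identity f = e(L u_f) *)
  (forall f, F f -> forall v : V, (forall x, O x -> rep v x = L (u f) x) ->
    De v /\ forall x, O x -> e v x = f x) ->
  (* e : Vn -> L2(O) is Lipschitz at v0 *)
  (forall n v, Vn n v -> De v /\ L2 O (e v)) ->
  (forall n v, Vn n v ->
    (L2norm O (fun x => e v x - e v0 x)%R <= (C * `|v - v0|)%:E)%E) ->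
  contracts P (fun n y (A : set ('rV[R]_d -> R)) => PiN n y A)
    (fun n w => observation (W n) (u f0) w)
    (fun f : 'rV[R]_d -> R => L2norm O (fun x => f x - f0 x)%R) eps.
Proof.
move=> _ _ _ _ _ _ Llin uP uniq gtP _ _ _ KP Os gtobs Kobs _ _ postN PiNL.
move=> Ff0 Lf0 repv0 [eps0 cL] mVn cVn eP VnD elip; split => // M Moo.
have ef0 x : O x -> e v0 x = f0 x by exact: (eP _ Ff0 _ repv0).2.
have uK : forall x, O x -> u f0 x = K v0 x + gt x.
  have [[Du Lu bu] _] := uP _ Ff0.
  (* [u f0] is taken as a solution with right-hand side [rep v0], the one that [K v0] has. *)
  apply: (pde_solution_decomposition Llin uniq gtP (KP v0)); split=> // x Ox.
  by rewrite repv0.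
have rec n : (fun w => recentre gt (observation (W n) (u f0) w)) =
    observation (W n) (K v0) by exact: recentre_observation.
(* [C] may be zero or negative; the maximum with 1 allows division and keeps [M n / C']
   divergent. *)
pose C' := Num.max C 1.
have C'0 : 0 < C' by rewrite lt_max ltr01 orbT.
have M'oo : (fun n => M n / C') @ \oo --> +oo.
  apply: (cvg_comp _ _ Moo (gt0_cvgMly (f := id) _ cvg_id)).
  by rewrite invr_gt0.
have mker d' (Z : measurableType d')
    (k : forall n, R.-pker (data R (obs_index O s n)) ~> Z) n B v :
    measurable B -> measurable_fun setT (fun w => k n (observation (W n) v w) B).
  move=> mB; apply: (measurableT_comp (measurable_kernel (k n) _ mB)).
  exact: measurable_observation.
apply: (cvg_in_probability_le_add _ _ _ _ (cL _ M'oo) cVn) => [n|n|n|].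
- by apply: mker; exact: measurable_L2norm_ge.
- by apply: mker; exact: measurable_normB_ge.
- exact: mker.
near=> n; have n0 : (0 < n)%N by near: n; exact: nbhs_infty_gt.
have [[mDe _] me _ _] := postN _ n0.
pose B : set (fun_space O) :=
  [set f | ((M n * eps n)%:E <= L2norm O (fun x => f x - f0 x)%R)%E].
have mB : measurable B by exact: measurable_L2norm_ge.
(* The exceptional null set may depend on [n] and on this [B], which is harmless since [n] is fixed
   here. *)
apply: filterS (PiNL _ n0 _ mB) => w ->.
rewrite (congr1 (@^~ w) (rec n)).
apply: probability_diff_bound => //; first exact: prob_kernel.
- exact: measurable_normB_ge.
(* [e] is measurable only on [De], hence the intersection with [De] in the event. *)
- exact: me mDe _ mB.
move=> v [[_ Bv] Vv] /=; rewrite lee_fin mulrAC ler_pdivrMr// [leRHS]mulrC.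
rewrite -lee_fin; apply: le_trans Bv _.
(* [e v0] and [f0] are known to agree on [O] only, which is all that [L2norm O] sees. *)
rewrite (@eq_L2norm _ _ _ _ (fun x => e v x - e v0 x)).
  by apply: le_trans (elip _ _ Vv) _; rewrite lee_fin ler_wpM2r// le_max lexx.
by move=> x Ox; rewrite ef0.
Unshelve. all: by end_near. Qed.
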